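(* Let $p\ge 1$ and let $\mathcal{C}\subseteq\mathbb{F}_2^p$ be a (not necessarily linear, nonempty) code of length $p$ and covering radius $r$ over $\mathbb{F}_2$. Let $\hat{c}=|\hat{\mathcal{C}}|$, where $\hat{\mathcal{C}}\subseteq\mathcal{C}$ contains exactly one of $\{\mathbf{c},\mathbf{c}\oplus\mathbf{1}\}$ for every $\mathbf{c}\in\mathcal{C}$. Then the pair $\left(\frac{p+\hat{c}}{p},\frac{r+1}{p}\right)$ is $\{\pm1\}$-feasible. Moreover, this pair can be obtained using systematic storage schemes, i.e., by an infinite family of $\{\pm1\}$-protocols each of whose encodings stores, for every $i\in[k]$, the entry $x_i$ in uncoded form at some server.
   Context: Protocols. Let $\mathcal{A}\subset\mathbb{R}$ be finite. An $\mathcal{A}$-protocol with parameters $(k,n,\ell)$ (positive integers, $n\ge k$) consists of a linear encoding $\mathbb{R}^k\to\mathbb{R}^n$, $\mathbf{x}\mapsto\mathbf{y}=(y_1,\dots,y_n)$ (each $y_i$ is a fixed linear combination of the entries of $\mathbf{x}$ and is stored on server $i$), together with, for every $\mathbf{w}\in\mathcal{A}^k$, a set $S_{\mathbf{w}}\subseteq[n]$ of at most $\ell$ servers (depending only on $\mathbf{w}$) and a decoding function that for every $\mathbf{x}\in\mathbb{R}^k$ computes $\mathbf{w}\mathbf{x}^\intercal$ from $(y_i)_{i\in S_{\mathbf{w}}}$. Feasibility. A pair $(\alpha,\beta)\in\mathbb{R}^2$ is $\mathcal{A}$-feasible if there is an infinite family of $\mathcal{A}$-protocols with parameters $\{(k_i,n_i,\ell_i)\}_{i\ge0}$,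 with $k_i$ strictly increasing, such that $\lim_{i\to\infty}(n_i/k_i,\ell_i/k_i)=(\alpha,\beta)$. Codes. The covering radius of $\mathcal{C}\subseteq\mathbb{F}_2^p$ is the minimum integer $r$ such that every vector of $\mathbb{F}_2^p$ is within Hamming distance $r$ of some codeword. $\oplus$ is addition in $\mathbb{F}_2^p$, and $\mathbf{1}$ is the all-ones vector. In the definition of $\hat{\mathcal{C}}$: if both $\mathbf{c}$ and $\mathbf{c}\oplus\mathbf{1}$ lie in $\mathcal{C}$, exactly one of them is in $\hat{\mathcal{C}}$; if $\mathbf{c}\in\mathcal{C}$ but $\mathbf{c}\oplus\mathbf{1}\notin\mathcal{C}$, then $\mathbf{c}\in\hat{\mathcal{C}}$. The size of $\hat{\mathcal{C}}$ does not depend on the choices made. *)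

(* Defs.v *)
From HB Require Import structures.
From mathcomp Require Import all_boot all_order all_algebra finmap.
From mathcomp Require Import boolp classical_sets reals topology normedtype.
From mathcomp Require Import sequences.

Set Implicit Arguments.
Unset Strict Implicit.
Unset Printing Implicit Defensive.

Import Order.TTheory GRing.Theory Num.Theory.
Import numFieldNormedType.Exports.

Local Open Scope classical_set_scope.
Local Open Scope ring_scope.

(* The types of [dec] and [decP] only give the decoder access to the entries
   stored on the servers in [servers w].  The values of [servers] and [dec] at
   vectors [w] outside A^k are irrelevant. *)
Record protocol (R : realType) (A : {fset R}) (k n l : nat) := Protocol {
  paramsP : [/\ (0 < k)%N, (0 < n)%N, (0 < l)%N & (k <= n)%N];
  encmx : 'M[R]_(k, n);
  enc : 'rV[R]_k -> 'rV[R]_n := fun x => x *m encmx;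
  servers : 'rV[R]_k -> {set 'I_n};
  dec : forall w : 'rV[R]_k, ({i : 'I_n | i \in servers w} -> R) -> R;
  serversP : forall w : 'rV[R]_k, (forall j, w 0 j \in A) ->
    (#|servers w| <= l)%N;
  decP : forall w : 'rV[R]_k, (forall j, w 0 j \in A) ->
    forall x : 'rV[R]_k,
      dec (fun i : {i : 'I_n | i \in servers w} => enc x 0 (val i)) =
      (w *m x^T) 0 0
}.

Definition systematic (R : realType) (A : {fset R}) (k n l : nat)
    (P : protocol A k n l) : Prop :=
  forall i : 'I_k, exists j : 'I_n, forall x : 'rV[R]_k, enc P x 0 j = x 0 i.

Definition feasible_using (R : realType) (A : {fset R})
    (Q : forall k n l : nat, protocol A k n l -> Prop) (ab : R * R) : Prop :=
  exists (k n l : nat -> nat) (P : forall i, protocol A (k i) (n i) (l i)),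
    [/\ forall i j, (i < j)%N -> (k i < k j)%N,
        forall i, Q (k i) (n i) (l i) (P i) &
        ((n i)%:R / (k i)%:R, (l i)%:R / (k i)%:R) @[i --> \oo] --> ab].

Definition feasible (R : realType) (A : {fset R}) (ab : R * R) : Prop :=
  feasible_using (fun k n l (_ : protocol A k n l) => True) ab.

Definition systematically_feasible (R : realType) (A : {fset R})
    (ab : R * R) : Prop :=
  feasible_using (@systematic R A) ab.

Definition hamming_dist (p : nat) (u v : 'rV['F_2]_p) : nat :=
  #|[pred i | u 0 i != v 0 i]|.

Definition covers (p : nat) (C : {set 'rV['F_2]_p}) (r : nat) : Prop :=
  forall u : 'rV['F_2]_p, exists2 c, c \in C & (hamming_dist u c <= r)%N.

Definition is_covering_radius (p : nat) (C : {set 'rV['F_2]_p}) (r : nat) :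
    Prop :=
  covers C r /\ forall s : nat, covers C s -> (r <= s)%N.

Definition is_complement_transversal (p : nat) (C Chat : {set 'rV['F_2]_p}) :
    Prop :=
  Chat \subset C /\
  forall c, c \in C -> (c \in Chat) (+) (c + const_mx 1 \in Chat).

(* Main.v *)
(* Split x into blocks of length p.  For each block b store its entries and the
   sums s_c b^T, for c in Chat, where s_c is the +-1 vector with signs c.  A +-1
   vector w of length p has signs u within distance r of some c in C, so
   w - s_c has at most r nonzero entries, and s_c is the stored vector of c or
   the opposite of that of c + 1: w b^T takes at most r + 1 servers.  With m
   blocks both ratios have exactly the announced values, whatever m is. *)
Require Import Defs.
From HB Require Import structures.
From mathcomp Require Import all_boot all_order all_algebra finmap.
From mathcomp Require Import boolp classical_sets reals topology normedtype.
From mathcomp Require Import sequences.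

Set Implicit Arguments.
Unset Strict Implicit.
Unset Printing Implicit Defensive.

Import Order.TTheory GRing.Theory Num.Theory.
Import numFieldNormedType.Exports.

Local Open Scope ring_scope.

Definition weight (R : nzRingType) (n : nat) (a : 'rV[R]_n) : nat :=
  (\sum_j (a 0%R j != 0%R))%N.

Lemma weight_row_mx (R : nzRingType) (n1 n2 : nat)
    (a : 'rV[R]_n1) (b : 'rV[R]_n2) :
  weight (row_mx a b) = (weight a + weight b)%N.
Proof.
rewrite /weight big_split_ord; congr (_ + _)%N; apply: eq_bigr => j _.
  by rewrite row_mxEl.
by rewrite row_mxEr.
Qed.

(** Linear decoding in matrix form: [a] lists the coefficients given to the stored entries, and its
    support is the set of servers that get read. *)
Definition computes (R : realType) (A : {fset R}) (k n : nat)
    (G : 'M[R]_(k, n)) (l : nat) : Prop :=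
  forall w : 'rV[R]_k, (forall j, w 0 j \in A) ->
    exists2 a : 'rV[R]_n, a *m G^T = w & (weight a <= l)%N.

Definition has_unit_cols (R : realType) (k n : nat) (G : 'M[R]_(k, n)) : Prop :=
  forall i : 'I_k, exists j : 'I_n, col j G = delta_mx i 0.

(** If [a *m G^T = w], then [w *m x^T = a *m (x *m G)^T], so the stored entries on the support of
    [a] determine the product. A unit column of [G] stores one entry of [x] uncoded. *)
Lemma protocol_of_mx (R : realType) (A : {fset R}) (k n l : nat)
    (G : 'M[R]_(k, n)) :
  [/\ (0 < k)%N, (0 < n)%N, (0 < l)%N & (k <= n)%N] ->
  computes A G l -> has_unit_cols G ->
  exists P : protocol A k n l, systematic P.
Proof.
move=> params compG unitG.
have /choice[a aP] : forall w : 'rV[R]_k, exists a : 'rV[R]_n,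
    (forall j, w 0 j \in A) -> a *m G^T = w /\ (weight a <= l)%N.
  move=> w; case: (pselect (forall j, w 0 j \in A)) => [wA|wNA].
    by have [a aG al] := compG w wA; exists a.
  (* Outside A^k any row will do. *)
  by exists 0 => /wNA.
pose S (w : 'rV[R]_k) := [set j | a w 0 j != 0]%SET.
pose D (w : 'rV[R]_k) (f : {i : 'I_n | i \in S w} -> R) := \sum_s a w 0 (val s) * f s.
have SP (w : 'rV[R]_k) : (forall j, w 0 j \in A) -> (#|S w| <= l)%N.
  move=> /aP[_]; apply: leq_trans.
  by rewrite -sum1_card big_mkcond leq_sum // => j _; rewrite inE; case: ifP.
have DP (w : 'rV[R]_k) : (forall j, w 0 j \in A) -> forall x : 'rV[R]_k,
    D w (fun i => (x *m G) 0 (val i)) = (w *m x^T) 0 0.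
  move=> /aP[aG _] x.
  rewrite -[in RHS]aG -mulmxA -trmx_mul mxE /D.
  (* Servers outside [S w] have coefficient 0; what is left of the sum is reindexed by the subtype
     that the decoder sees. *)
  rewrite (bigID (mem (S w))) /= [X in _ + X]big1 ?addr0; last first.
    by move=> j; rewrite inE negbK => /eqP ->; rewrite mul0r.
  rewrite (reindex_omap (val : {i | i \in S w} -> 'I_n) insub); last first.
    by move=> j jS; rewrite insubT.
  apply: eq_big => [[j jS]|s _]; last by rewrite [in RHS]mxE.
  by rewrite jS insubT /= eqxx.
exists (Protocol params SP DP) => i.
have [j Gj] := unitG i; exists j => x.
have -> : enc (Protocol params SP DP) x 0 j = (x *m col j G) 0 0.
  by rewrite !mxE; apply: eq_bigr => t _; rewrite mxE.
by rewrite Gj -colE mxE.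
Qed.

(** The two halves of [w] are decoded independently, each from its own servers, so the weights add
    up. *)
Lemma computes_block (R : realType) (A : {fset R}) (k1 n1 l1 k2 n2 l2 : nat)
    (G1 : 'M[R]_(k1, n1)) (G2 : 'M[R]_(k2, n2)) :
  computes A G1 l1 -> computes A G2 l2 ->
  computes A (block_mx G1 0 0 G2) (l1 + l2).
Proof.
move=> comp1 comp2 w wA.
have [j|a1 a1G a1l] := comp1 (lsubmx w); first by rewrite mxE.
have [j|a2 a2G a2l] := comp2 (rsubmx w); first by rewrite mxE.
exists (row_mx a1 a2); last by rewrite weight_row_mx leq_add.
rewrite tr_block_mx !trmx0 mul_row_block !mulmx0 addr0 add0r a1G a2G.
exact: hsubmxK.
Qed.

Lemma has_unit_cols_block (R : realType) (k1 n1 k2 n2 : nat)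
    (G1 : 'M[R]_(k1, n1)) (G2 : 'M[R]_(k2, n2)) :
  has_unit_cols G1 -> has_unit_cols G2 -> has_unit_cols (block_mx G1 0 0 G2).
Proof.
move=> unit1 unit2 i; rewrite -(splitK i); case: (split i) => t /=.
  have [j Gj] := unit1 t; exists (lshift n2 j).
  by rewrite block_mxEh colKl col_col_mx Gj col0 -[RHS]vsubmxK; congr col_mx;
    apply/matrixP => s z; rewrite !mxE ?eq_lshift ?eq_rlshift.
have [j Gj] := unit2 t; exists (rshift n1 j).
by rewrite block_mxEh colKr col_col_mx Gj col0 -[RHS]vsubmxK; congr col_mx;
  apply/matrixP => s z; rewrite !mxE ?eq_rshift ?eq_lrshift.
Qed.

Lemma block_diag_power (R : realType) (A : {fset R}) (k n l : nat)
    (G : 'M[R]_(k, n)) (m : nat) :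
  computes A G l -> has_unit_cols G ->
  exists2 Gm : 'M[R]_(m * k, m * n),
    computes A Gm (m * l) & has_unit_cols Gm.
Proof.
move=> compG unitG; elim: m => [|m [Gm compGm unitGm]].
  exists 0 => [w _|[]//]; exists 0; last by rewrite /weight big_ord0.
  by rewrite mul0mx; apply/rowP => -[].
(* The dimensions agree by conversion: [m.+1 * k] unfolds to [k + m * k]. *)
exists (block_mx G 0 0 Gm); first exact: computes_block.
exact: has_unit_cols_block.
Qed.

Definition sign2 (R : nzRingType) (b : 'F_2) : R := if b == 0 then 1 else -1.

(** This is why one codeword of each complementary pair is enough: the sign vector of the other is
    its opposite. *)
Lemma sign2D1 (R : nzRingType) (b : 'F_2) : sign2 R (b + 1) = - sign2 R b.
Proof. by case: b => [[|[|//]] ?]; rewrite /sign2 /= ?opprK. Qed.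

Definition code_mx (R : realType) (p : nat) (D : {set 'rV['F_2]_p}) :
    'M[R]_(p, p + #|D|) :=
  row_mx 1%:M (\matrix_(i, j) sign2 R (@enum_val _ (mem D) j 0 i)).

Lemma code_mx_unit_cols (R : realType) (p : nat) (D : {set 'rV['F_2]_p}) :
  has_unit_cols (code_mx R D).
Proof.
move=> i; exists (lshift _ i); rewrite colKl.
by apply/matrixP => s z; rewrite !mxE ord1 eqxx andbT.
Qed.

Lemma code_mx_computes (R : realType) (p : nat) (C Chat : {set 'rV['F_2]_p})
    (r : nat) :
  covers C r -> is_complement_transversal C Chat ->
  computes [fset 1; -1]%fset (code_mx R Chat) (r + 1).
Proof.
move=> covC [_ transC] w wA.
have [u wE] : exists u : 'rV['F_2]_p, forall i, w 0 i = sign2 R (u 0 i).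
  exists (\row_i (w 0 i == -1)%:R) => i; rewrite mxE /sign2.
  have := wA i; rewrite !inE; case: (w 0 i =P -1) => [->//|_].
  by rewrite orbF => /eqP.
have [c cC uc] := covC u.
(* [d] is whichever of [c] and its complement is stored, and [s] is 1 or -1 accordingly. *)
have [d [dChat [s sP]]] : exists d, d \in Chat /\
    exists s : R, forall i, s * sign2 R (d 0 i) = sign2 R (c 0 i).
  have := transC c cC; case: (boolP (c \in Chat)) => [cChat _|_ /= dChat].
    by exists c; split=> //; exists 1 => i; rewrite mul1r.
  exists (c + const_mx 1); split=> //; exists (-1) => i.
  by rewrite !mxE sign2D1 mulN1r opprK.
pose e := \row_i sign2 R (c 0 i).
pose t := enum_rank_in dChat d.
(* The server of [d] contributes [e], up to the sign [s]; the uncoded entries supply the correction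
   [w - e]. *)
exists (row_mx (w - e) (s *: delta_mx 0 t)).
  rewrite tr_row_mx mul_row_col trmx1 mulmx1 -scalemxAl -rowE.
  apply/rowP => i; rewrite !mxE enum_rankK_in // sP.
  by rewrite subrK.
rewrite weight_row_mx leq_add //.
  (* [w - e] vanishes wherever [u] and [c] agree, hence at most r nonzero entries. *)
  apply: leq_trans uc; rewrite /hamming_dist -sum1_card big_mkcond leq_sum // => i _.
  rewrite !inE !mxE wE.
  by case: (u 0 i =P c 0 i) => [->|_]; rewrite ?subrr ?eqxx ?leq_b1.
rewrite /weight (bigD1 t) //= big1 ?addn0 ?leq_b1 // => j jt.
by rewrite !mxE eqxx (negbTE jt) mulr0 eqxx.
Qed.

Theorem theorem2 (R : realType) (p : nat) (hp : (0 < p)%N)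
    (C : {set 'rV['F_2]_p}) (hC : C != finset.set0) (r : nat)
    (hr : is_covering_radius C r)
    (Chat : {set 'rV['F_2]_p}) (hChat : is_complement_transversal C Chat) :
  let A : {fset R} := [fset 1; -1]%fset in
  let ab : R * R := ((p%:R + #|Chat|%:R) / p%:R, (r%:R + 1) / p%:R) in
  feasible A ab /\ systematically_feasible A ab.
Proof.
move=> A ab.
suff sysf : systematically_feasible A ab.
  split=> //; have [k [n [l [P [kinc _ lim]]]]] := sysf.
  by exists k, n, l, P; split.
(* Taking [m.+1] blocks keeps all parameters positive from the first protocol on. *)
have ex (m : nat) : exists P : protocol A (m.+1 * p) (m.+1 * (p + #|Chat|))
    (m.+1 * (r + 1)), systematic P.
  have [G compG unitG] := block_diag_power m.+1
    (code_mx_computes (R := R) hr.1 hChat) (@code_mx_unit_cols R p Chat).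
  apply: (protocol_of_mx _ compG unitG).
  by rewrite !muln_gt0 !addn_gt0 hp orbT leq_mul2l leq_addr orbT.
exists (fun m => m.+1 * p)%N, (fun m => m.+1 * (p + #|Chat|))%N,
  (fun m => m.+1 * (r + 1))%N, (fun m => projT1 (cid (ex m))).
split=> [i j ij|i|]; first by rewrite ltn_pmul2r.
  exact: projT2 (cid (ex i)).
(* The number of blocks cancels, so the sequence of pairs is constant. *)
have ratio (m b : nat) : (m.+1 * b)%:R / (m.+1 * p)%:R = b%:R / p%:R :> R.
  by rewrite !natrM -mulf_div divff ?mul1r // pnatr_eq0.
under eq_fun do rewrite !ratio !natrD.
exact: cvg_cst.
Qed.
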